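(* Let $A\subseteq\omega$ be a nonrecursive computably enumerable (c.e.) set which is $D$-maximal. Then the many-one degree of $A$ contains a least finite-one degree, i.e. there is a set $C$ with $C\equiv_{\rm m} A$ such that $C\le_{\rm fo} B$ for every set $B$ with $B\equiv_{\rm m} A$.
   Context: All sets are subsets of $\omega$. $A\le_{\rm m} B$ means there is a total computable $f$ with $x\in A\iff f(x)\in B$ for all $x$; $A\equiv_{\rm m}B$ means $A\le_{\rm m}B$ and $B\le_{\rm m}A$. $A\le_{\rm fo} B$ (finite-one reducibility) means there is a total computable $g\colon\omega\to\omega$ with $x\in A\iff g(x)\in B$ for all $x$ and such that every fibre $g^{-1}(\{y\})$ is finite. A noncomputable c.e. set $A$ is $D$-maximal if for every c.e. set $W\supseteq A$, either $W\setminus A$ is c.e., or there is a computable set $R$ with $A\subseteq R\subseteq W$. *)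

(* Defs.v *)
From mathcomp Require Import all_boot.
From mathcomp Require Import boolp classical_sets cardinality.

Set Implicit Arguments.
Unset Strict Implicit.
Unset Printing Implicit Defensive.

Local Open Scope classical_set_scope.

(* An n-ary partial function is represented by its graph: [f v y] means that
   f is defined at v with value y. *)
Definition pfun_graph (n : nat) : Type := n.-tuple nat -> nat -> Prop.

(* All the components of the inner tuple must converge, even those that [f]
   does not look at. *)
Definition compose_graph (m n : nat) (f : pfun_graph m)
    (g : 'I_m -> pfun_graph n) : pfun_graph n :=
  fun v y => exists u : m.-tuple nat, (forall i, g i v (tnth u i)) /\ f u y.

(* h(0, v) = f(v),  h(k+1, v) = g(k, h(k, v), v). *)
Fixpoint primrec_graph (n : nat) (f : pfun_graph n) (g : pfun_graph n.+2)
    (k : nat) (v : n.-tuple nat) : nat -> Prop :=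
  match k with
  | 0 => f v
  | k'.+1 => fun y => exists z : nat,
      primrec_graph f g k' v z /\ g [tuple of k' :: z :: v] y
  end.

(* The search fails if some f(i, v) with i below the first zero diverges. *)
Definition mu_graph (n : nat) (f : pfun_graph n.+1) : pfun_graph n :=
  fun v y => f [tuple of y :: v] 0 /\
    forall i, i < y -> exists z : nat, f [tuple of i :: v] z.+1.

Inductive partial_recursive : forall n : nat, pfun_graph n -> Prop :=
| PRzero (n : nat) :
    partial_recursive (fun (_ : n.-tuple nat) y => y = 0)
| PRsucc :
    partial_recursive (fun (v : 1.-tuple nat) y => y = (thead v).+1)
| PRproj (n : nat) (i : 'I_n) :
    partial_recursive (fun (v : n.-tuple nat) y => y = tnth v i)
| PRcomp (m n : nat) (f : pfun_graph m) (g : 'I_m -> pfun_graph n) :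
    partial_recursive f -> (forall i, partial_recursive (g i)) ->
    partial_recursive (compose_graph f g)
| PRrec (n : nat) (f : pfun_graph n) (g : pfun_graph n.+2) :
    partial_recursive f -> partial_recursive g ->
    partial_recursive (fun (v : n.+1.-tuple nat) y =>
      primrec_graph f g (thead v) [tuple of behead v] y)
| PRmu (n : nat) (f : pfun_graph n.+1) :
    partial_recursive f -> partial_recursive (mu_graph f).

Definition computable_fun (f : nat -> nat) : Prop :=
  partial_recursive (fun (v : 1.-tuple nat) y => y = f (thead v)).

(* [x \in A] is the classical boolean truth value of [A x]. *)
Definition computable_set (A : set nat) : Prop :=
  computable_fun (fun x => nat_of_bool (x \in A)).

Definition ce (A : set nat) : Prop :=
  A = set0 \/ exists f : nat -> nat, computable_fun f /\ A = range f.

Definition m_reducible (A B : set nat) : Prop :=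
  exists f : nat -> nat, computable_fun f /\ forall x, A x <-> B (f x).

Definition m_equivalent (A B : set nat) : Prop :=
  m_reducible A B /\ m_reducible B A.

Definition fo_reducible (A B : set nat) : Prop :=
  exists g : nat -> nat,
    [/\ computable_fun g, (forall x, A x <-> B (g x)) &
        forall y, finite_set (g @^-1` [set y])].

Definition D_maximal (A : set nat) : Prop :=
  [/\ ce A, ~ computable_set A &
      forall W : set nat, ce W -> A `<=` W ->
        ce (W `\` A) \/
        exists R : set nat, [/\ computable_set R, A `<=` R & R `<=` W]].

(* Main.v *)
Require Import Defs.
From mathcomp Require Import all_boot.
From mathcomp Require Import boolp classical_sets cardinality.
From mathcomp Require Import zify.

Set Implicit Arguments.
Unset Strict Implicit.
Unset Printing Implicit Defensive.

Local Open Scope classical_set_scope.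

(* For f : nat -> nat let [repeats f] be the computable set of those x with
   f y = f x for some y < x.  Given a reduction f of A to some B0, put
   C = A U repeats f; then C is many-one equivalent to A.

   Let q reduce C to B.  D-maximality, applied to the union of A and the set of
   x such that the least element of the f-fibre of x lies in [repeats q], shows
   that [repeats q \ C] is c.e.: the other alternative would make A computable.
   A finite-one reduction of C to B agrees with q off [repeats q], where q is
   injective, sends n in [repeats q & C] to an element of B above n, and sends
   n in [repeats q \ C] to some d(n) outside B.

   If the complement of every B equivalent to A has an infinite c.e. subset,
   take f = id, so C = A, and choose d(n) >= n in such a subset.  Otherwise take
   B0 equivalent to A with no infinite c.e. subset in its complement.  As f is
   injective off C, the complement of C has none either, so [repeats q \ C] is
   finite and a constant d will do. *)

(** * Closure properties of total recursive functions *)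

Definition recursive_fun (n : nat) (F : n.-tuple nat -> nat) : Prop :=
  partial_recursive (fun v y => y = F v).

Lemma partial_recursive_ext n (f g : pfun_graph n) :
  partial_recursive f -> (forall v y, f v y <-> g v y) -> partial_recursive g.
Proof.
move=> fR fg; suff -> : g = f by [].
by apply/funext => v; apply/funext => y; apply/propext; split=> /fg.
Qed.

Lemma recursive_fun_comp m n (F : m.-tuple nat -> nat)
    (G : 'I_m -> n.-tuple nat -> nat) :
  recursive_fun F -> (forall i, recursive_fun (G i)) ->
  recursive_fun (fun v => F [tuple G i v | i < m]).
Proof.
move=> FR GR; apply: partial_recursive_ext (PRcomp FR GR) _ => v y; split.
  case=> u [uG ->]; congr F; apply: eq_from_tnth => i.
  by rewrite uG tnth_mktuple.
by move=> ->; exists [tuple G i v | i < m]; split=> // i; rewrite tnth_mktuple.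
Qed.

Lemma recursive_proj n (i : 'I_n) : recursive_fun (fun v => tnth v i).
Proof. exact: PRproj. Qed.

Lemma recursive_comp1 n (f : nat -> nat) (F : n.-tuple nat -> nat) :
  computable_fun f -> recursive_fun F -> recursive_fun (fun v => f (F v)).
Proof.
move=> fR FR; have := recursive_fun_comp fR (fun _ : 'I_1 => FR).
move/partial_recursive_ext; apply=> v y.
by rewrite /thead tnth_mktuple.
Qed.

Definition recursive2 (f : nat -> nat -> nat) : Prop :=
  recursive_fun (fun v : 2.-tuple nat => f (tnth v ord0) (tnth v ord_max)).

Lemma recursive_comp2 n (f : nat -> nat -> nat) (F G : n.-tuple nat -> nat) :
  recursive2 f -> recursive_fun F -> recursive_fun G ->
  recursive_fun (fun v => f (F v) (G v)).
Proof.
move=> fR FR GR.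
have HR (i : 'I_2) : recursive_fun (if i == ord0 then F else G) by case: ifP.
have := recursive_fun_comp fR HR.
by move/partial_recursive_ext; apply=> v y; rewrite !tnth_mktuple.
Qed.

Lemma recursive_const n (c : nat) : recursive_fun (fun _ : n.-tuple nat => c).
Proof.
elim: c => [|c IHc]; first exact: PRzero.
by apply: (recursive_comp1 _ IHc); exact: PRsucc.
Qed.

Lemma recursive_succ n (F : n.-tuple nat -> nat) :
  recursive_fun F -> recursive_fun (fun v => (F v).+1).
Proof. by apply: recursive_comp1; exact: PRsucc. Qed.

Lemma recursive2_primrec (h : nat -> nat -> nat) (f : nat -> nat)
    (g : 3.-tuple nat -> nat) :
  computable_fun f -> recursive_fun g ->
  (forall x, h 0 x = f x) ->
  (forall k x, h k.+1 x = g [tuple k; h k x; x]) ->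
  recursive2 h.
Proof.
move=> fR gR h0 hS; apply: partial_recursive_ext (PRrec fR gR) _ => v y.
have -> : thead v = tnth v ord0 by [].
have -> : tnth v ord_max = thead [tuple of behead v].
  by rewrite /thead !(tnth_nth 0) /= nth_behead.
move: [tuple of behead v] (tnth v ord0) y => w; elim=> [|k IHk] y /=.
  by rewrite h0.
have gE z : [tuple of k :: z :: w] = [tuple k; z; thead w].
  by apply/val_inj; case: w {IHk} => -[|a []].
split=> [[z [/IHk -> ->]]|->]; first by rewrite hS gE.
by exists (h k (thead w)); split; [apply/IHk | rewrite hS gE].
Qed.

(** [mu_graph] searches for a zero, so the search runs on the negation of [P]; all earlier values
    are defined because the test is total. *)
Lemma recursive_mu n (P : n.+1.-tuple nat -> bool) (g : n.-tuple nat -> nat) :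
  recursive_fun (fun v => nat_of_bool (~~ P v)) ->
  (forall v : n.-tuple nat, P [tuple of g v :: v]) ->
  (forall (v : n.-tuple nat) i, P [tuple of i :: v] -> g v <= i) ->
  recursive_fun g.
Proof.
move=> PR Pg gmin; apply: partial_recursive_ext (PRmu PR) _ => v y; split.
  case=> Py lty; apply/eqP; rewrite eqn_leq gmin ?andbT; last first.
    by case: (P _) Py.
  rewrite leqNgt; apply/negP => /lty [z]; by rewrite Pg.
move=> ->; split=> [|i ltig]; first by rewrite Pg.
exists 0; case Pi: (P _) => //.
by have := gmin _ _ Pi; rewrite leqNgt ltig.
Qed.

Lemma recursive_add n (F G : n.-tuple nat -> nat) :
  recursive_fun F -> recursive_fun G -> recursive_fun (fun v => F v + G v).
Proof.
apply: recursive_comp2.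
apply: (@recursive2_primrec _ id (fun v => (tnth v (inord 1)).+1)) => //.
- exact: recursive_proj.
- by apply: recursive_succ; exact: recursive_proj.
- by move=> k x; rewrite (tnth_nth 0) inordK.
Qed.

Lemma recursive_mul n (F G : n.-tuple nat -> nat) :
  recursive_fun F -> recursive_fun G -> recursive_fun (fun v => F v * G v).
Proof.
apply: recursive_comp2.
apply: (@recursive2_primrec _ (fun=> 0)
  (fun v => tnth v (inord 2) + tnth v (inord 1))) => //.
- exact: recursive_const.
- by apply: recursive_add; exact: recursive_proj.
- by move=> k x; rewrite !(tnth_nth 0) !inordK.
Qed.

(** The recursion step returns its counter. The parameter is a dummy, removed by identifying the two
    arguments. *)
Lemma computable_pred : computable_fun predn.
Proof.
have pR : recursive2 (fun k _ => k.-1).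
  apply: (@recursive2_primrec _ (fun=> 0) (fun v => tnth v (inord 0))) => //.
  - exact: recursive_const.
  - exact: recursive_proj.
  - by move=> k x; rewrite (tnth_nth 0) inordK.
exact: (recursive_comp2 pR (@recursive_proj 1 ord0) (@recursive_proj 1 ord0)).
Qed.

Lemma recursive_sub n (F G : n.-tuple nat -> nat) :
  recursive_fun F -> recursive_fun G -> recursive_fun (fun v => F v - G v).
Proof.
(* Recursion acts on the first argument, so the operands are swapped: the subtrahend counts how
   often the predecessor is taken. *)
move=> FR GR; apply: (@recursive_comp2 _ (fun k x => x - k) _ _ _ GR FR).
apply: (@recursive2_primrec _ id (fun v => (tnth v (inord 1)).-1)) => //.
- exact: recursive_proj.
- by apply: recursive_comp1 computable_pred _; exact: recursive_proj.
- by move=> x; rewrite subn0.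
- by move=> k x; rewrite (tnth_nth 0) inordK //= subnS.
Qed.

Lemma recursive_negb n (P : n.-tuple nat -> bool) :
  recursive_fun P -> recursive_fun (fun v => ~~ P v).
Proof.
move=> PR; have := recursive_sub (recursive_const n 1) PR.
by move/partial_recursive_ext; apply=> v y; case: (P v).
Qed.

Lemma recursive_leq n (F G : n.-tuple nat -> nat) :
  recursive_fun F -> recursive_fun G -> recursive_fun (fun v => F v <= G v).
Proof.
move=> FR GR.
have := recursive_sub (recursive_const n 1) (recursive_sub FR GR).
by move/partial_recursive_ext; apply=> v y; rewrite -subn_eq0; case: (F v - G v).
Qed.

Lemma recursive_if n (P : n.-tuple nat -> bool) (F G : n.-tuple nat -> nat) :
  recursive_fun P -> recursive_fun F -> recursive_fun G ->
  recursive_fun (fun v => if P v then F v else G v).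
Proof.
move=> PR FR GR.
have := recursive_add (recursive_mul PR FR) (recursive_mul (recursive_negb PR) GR).
move/partial_recursive_ext; apply=> v y.
by case: (P v); rewrite mul1n mul0n ?addn0.
Qed.

Lemma recursive_orb n (P Q : n.-tuple nat -> bool) :
  recursive_fun P -> recursive_fun Q -> recursive_fun (fun v => P v || Q v).
Proof.
move=> PR QR; have := recursive_if PR (recursive_const n 1) QR.
by move/partial_recursive_ext; apply=> v y; case: (P v).
Qed.

Lemma recursive_eq n (F G : n.-tuple nat -> nat) :
  recursive_fun F -> recursive_fun G -> recursive_fun (fun v => F v == G v).
Proof.
move=> FR GR.
have := recursive_if (recursive_leq FR GR) (recursive_leq GR FR) (recursive_const n 0).
by move/partial_recursive_ext; apply=> v y; rewrite eqn_leq; case: (F v <= G v).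
Qed.

Lemma computable_comp (f g : nat -> nat) :
  computable_fun f -> computable_fun g -> computable_fun (fun x => f (g x)).
Proof. exact: recursive_comp1. Qed.

Lemma computable_id : computable_fun id.
Proof. exact: recursive_proj. Qed.

Lemma computable_mu (P : nat -> nat -> bool) (g : nat -> nat) :
  recursive2 (fun y x => P y x) ->
  (forall x, P (g x) x) -> (forall x i, P i x -> g x <= i) ->
  computable_fun g.
Proof.
move=> PR Pg gmin.
have thE y (v : 1.-tuple nat) : tnth [tuple of y :: v] ord_max = thead v.
  by rewrite /thead !(tnth_nth 0).
apply: (recursive_mu (recursive_negb PR)) => [v|v i]; rewrite thE.
  exact: Pg.
exact: gmin.
Qed.

Lemma computable_search (P : nat -> nat -> bool) :
  recursive2 (fun y x => P y x) -> (forall x, exists y, P y x) ->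
  exists2 g, computable_fun g & forall x, P (g x) x.
Proof.
move=> PR exP; exists (fun x => ex_minn (exP x)) => [|x].
  apply: (computable_mu PR) => x; first by case: ex_minnP.
  by move=> i; case: ex_minnP => m _; apply.
by case: ex_minnP.
Qed.

Lemma recursive_mem n (X : set nat) (F : n.-tuple nat -> nat) :
  computable_set X -> recursive_fun F -> recursive_fun (fun v => F v \in X).
Proof. exact: recursive_comp1. Qed.

Ltac recursive_step :=
  lazymatch goal with
  | |- computable_fun ?f =>
      change (recursive_fun (fun v : 1.-tuple nat => f (thead v))); cbv beta
  | |- recursive2 _ => rewrite /recursive2
  | |- recursive_fun (fun v => tnth v _) => exact: recursive_proj
  | |- recursive_fun (fun v => thead v) => exact: recursive_proj
  | |- recursive_fun (@thead _ _) => exact: recursive_proj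
  | |- recursive_fun (fun v => nat_of_bool (_ || _)) => apply: recursive_orb
  | |- recursive_fun (fun v => nat_of_bool (~~ _)) => apply: recursive_negb
  | |- recursive_fun (fun v => nat_of_bool (_ == _)) => apply: recursive_eq
  | |- recursive_fun (fun v => nat_of_bool (_ <= _)) => apply: recursive_leq
  | |- recursive_fun (fun v => nat_of_bool (_ \in _)) => apply: recursive_mem
  | |- recursive_fun (fun v => if _ then _ else _) => apply: recursive_if
  | |- recursive_fun (fun v => _ + _) => apply: recursive_add
  | |- recursive_fun (fun v => _ - _) => apply: recursive_sub
  | |- recursive_fun (fun v => _ * _) => apply: recursive_mul
  | |- recursive_fun (fun v => _.+1) => apply: recursive_succ
  | |- recursive_fun (fun v => ?f _) =>
      match goal with
      | H : computable_fun f |- _ => apply: (recursive_comp1 H)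
      | H : recursive2 _ |- _ => exact: H
      end
  | |- recursive_fun _ => exact: recursive_const
  | |- computable_set _ => assumption
  end.

Ltac recursive_tac := repeat recursive_step.

(** * Computable sets and c.e. sets *)

Lemma computable_set_pred (p : pred nat) (X : set nat) :
  computable_fun p -> (forall x, p x <-> X x) -> computable_set X.
Proof.
move=> pR pX; have E x : (x \in X) = p x.
  by apply/idP/idP => [/set_mem/pX|/pX/mem_set].
by apply: partial_recursive_ext pR _ => v y; rewrite E.
Qed.

Lemma computable_finite (X : set nat) : finite_set X -> computable_set X.
Proof.
move=> /finite_seqP[s ->]; apply: (@computable_set_pred (fun x => x \in s)) => //.
elim: s => [|a s IHs]; first exact: recursive_const.
have: recursive_fun (fun v : 1.-tuple nat => (thead v == a) || (thead v \in s)).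
  by apply: recursive_orb IHs; recursive_tac.
exact.
Qed.

(* Every pair of numbers is (n - s^2, s - (n - s^2)) for some n, where s is the
   integer square root of n. *)
Lemma computable_unpair : exists u w : nat -> nat,
  [/\ computable_fun u, computable_fun w &
      forall x k, exists2 n, u n = x & w n = k].
Proof.
pose P s n := n < s.+1 * s.+1.
have exP n : exists s, P s n.
  by exists n; rewrite /P mulSn ltnS leq_addr.
pose r n := ex_minn (exP n).
have rR : computable_fun r.
  apply: (@computable_mu P); rewrite /P /recursive2; first by recursive_tac.
    by move=> n; rewrite /r; case: ex_minnP.
  by move=> n i; rewrite /r; case: ex_minnP => m _; apply.
exists (fun n => n - r n * r n), (fun n => r n - (n - r n * r n)).
split=> [||x k]; [recursive_tac..|].
pose s := x + k.
have rE : r (s * s + x) = s.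
  rewrite /r; case: ex_minnP => m Pm minm; apply/eqP; rewrite eqn_leq.
  rewrite minm /=; last first.
    by rewrite /P /s; nia.
  rewrite leqNgt; apply/negP => ltms; move: Pm; rewrite /P ltnNge.
  by rewrite (leq_trans (leq_mul ltms ltms)) ?leq_addr.
by exists (s * s + x); rewrite rE addKn // /s addKn.
Qed.

(** The enumeration runs through all coded pairs of a number and a candidate witness. It outputs the
    number if the witness is valid, and otherwise the default element [x0], which keeps it total. *)
Lemma ce_ex (P : nat -> nat -> bool) :
  recursive2 (fun k x => P k x) -> ce [set x | exists k, P k x].
Proof.
move=> PR; set X := [set x | _]; have [X0|/eqP/set0P[x0 Xx0]] := pselect (X = set0).
  by left.
right; have [u [w [uR wR uwE]]] := computable_unpair.
exists (fun n => if P (w n) (u n) then u n else x0); split.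
  recursive_tac; apply: (recursive_comp2 PR); recursive_tac.
apply/seteqP; split=> [x [k Pkx]|_ [n _ <-]].
  by have [n un wn] := uwE x k; exists n; rewrite // un wn Pkx.
by case: ifP => // Pn; exists (w n).
Qed.

Lemma ce_image (X : set nat) (f : nat -> nat) :
  computable_fun f -> ce X -> ce (f @` X).
Proof.
move=> fR [->|[e [eR ->]]]; first by left; rewrite image_set0.
by right; exists (fun n => f (e n)); split; [exact: computable_comp|rewrite image_comp].
Qed.

Lemma ce_preimage (X : set nat) (f : nat -> nat) :
  computable_fun f -> ce X -> ce (f @^-1` X).
Proof.
move=> fR [->|[e [eR ->]]]; first by left; rewrite preimage_set0.
suff -> : f @^-1` range e = [set x | exists k, e k == f x].
  by apply: ce_ex; recursive_tac.
apply/seteqP; split=> x /= [k]; first by move=> _ ekE; exists k; apply/eqP.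
by move=> /eqP ekE; exists k.
Qed.

Lemma ce_computable (X : set nat) : computable_set X -> ce X.
Proof.
move=> XR; suff -> : X = [set x | exists k : nat, x \in X].
  by apply: ce_ex; recursive_tac.
apply/seteqP; split=> x /=; first by exists 0; apply/mem_set.
by case=> _ /set_mem.
Qed.

Lemma ceU (X Y : set nat) : ce X -> ce Y -> ce (X `|` Y).
Proof.
case=> [->|[e [eR ->]]]; first by rewrite set0U.
case=> [->|[e' [e'R ->]]]; first by rewrite setU0; right; exists e.
suff -> : range e `|` range e' = [set x | exists k, (e k == x) || (e' k == x)].
  by apply: ce_ex; recursive_tac.
apply/seteqP; split=> x /=.
  by case=> -[k _ <-]; exists k; rewrite eqxx ?orbT.
by case=> k /orP[]/eqP <-; [left|right]; exists k.
Qed.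

(** Post's theorem: every number shows up in one of the two enumerations, and a joint search tells
    which one. *)
Lemma ce_compl_computable (X : set nat) : ce X -> ce (~` X) -> computable_set X.
Proof.
move=> [->|[e [eR XE]]].
  by move=> _; exact: computable_finite (finite_set0 _).
case=> [X0|[e' [e'R X'E]]].
  apply: (@computable_set_pred predT) => [|x]; first exact: recursive_const.
  by split=> // _; rewrite -[X]setCK X0 setC0.
have [||g gR gP] := @computable_search (fun k x => (e k == x) || (e' k == x)).
- by recursive_tac.
- move=> x; have [|] := pselect (X x).
    by rewrite XE => -[k _ <-]; exists k; rewrite eqxx.
  rewrite -[~ X x]/((~` X) x) X'E => -[k _ <-].
  by exists k; rewrite eqxx orbT.
apply: (@computable_set_pred (fun x => e (g x) == x)) => [|x].
  by recursive_tac.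
split=> [/eqP <-|Xx]; first by rewrite XE; exists (g x).
have /orP[//|/eqP e'x] := gP x.
suff : (~` X) x by [].
by rewrite X'E; exists (g x).
Qed.

Lemma computable_preimage (X : set nat) (f : nat -> nat) :
  computable_fun f -> computable_set X -> computable_set (f @^-1` X).
Proof.
move=> fR XR; apply: (@computable_set_pred (fun x => f x \in X)) => [|x].
  by recursive_tac.
by rewrite in_setE.
Qed.

(** * Many-one reductions and unbounded c.e. sets *)

Lemma reduction_preimage (X Y : set nat) (f : nat -> nat) :
  (forall x, X x <-> Y (f x)) -> X = f @^-1` Y.
Proof. by move=> fXY; apply/seteqP; split=> x /fXY. Qed.

Lemma m_reducible_trans (X Y Z : set nat) :
  m_reducible X Y -> m_reducible Y Z -> m_reducible X Z.
Proof.
move=> [f [fR fXY]] [g [gR gYZ]]; exists (fun x => g (f x)); split.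
  exact: computable_comp.
by move=> x; rewrite fXY gYZ.
Qed.

Lemma ce_m_reducible (X Y : set nat) : m_reducible X Y -> ce Y -> ce X.
Proof. by move=> [f [fR /reduction_preimage ->]]; exact: ce_preimage. Qed.

Lemma computable_m_reducible (X Y : set nat) :
  m_reducible X Y -> computable_set Y -> computable_set X.
Proof. by move=> [f [fR /reduction_preimage ->]]; exact: computable_preimage. Qed.

Lemma infinite_nat_unbounded (X : set nat) n :
  infinite_set X -> exists2 x, X x & n <= x.
Proof.
move=> infX; apply: contrapT => nX; apply: infX.
apply: (@sub_finite_set _ _ `I_n) => // x Xx /=.
by rewrite ltnNge; apply/negP => lenx; apply: nX; exists x.
Qed.

(** The bound [n <= b n] is what makes the fibres of [b] finite. *)
Lemma infinite_ce_above (X : set nat) : ce X -> infinite_set X ->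
  exists b : nat -> nat,
    [/\ computable_fun b, (forall n, X (b n)) & forall n, n <= b n].
Proof.
move=> [->|[e [eR XE]] infX]; first by move/(_ (finite_set0 _)).
have [||k kR kP] := @computable_search (fun k n => n <= e k).
- by recursive_tac.
- move=> n; have [x] := infinite_nat_unbounded n infX.
  by rewrite XE => -[k _ <-]; exists k.
exists (fun n => e (k n)); split=> //; first exact: computable_comp.
by move=> n; rewrite XE; exists (k n).
Qed.

(** * Least elements of fibres *)

Lemma exists_same_value (f : nat -> nat) x : exists y, f y == f x.
Proof. by exists x. Qed.

Definition first (f : nat -> nat) x := ex_minn (exists_same_value f x).

Lemma firstK f x : f (first f x) = f x.
Proof. by rewrite /first; case: ex_minnP => m /eqP. Qed.

Lemma first_min f x y : f y = f x -> first f x <= y.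
Proof. by rewrite /first; case: ex_minnP => m _ minm /eqP/minm. Qed.

Lemma eq_first f x y : f x = f y -> first f x = first f y.
Proof.
by move=> fxy; apply/eqP; rewrite eqn_leq !first_min ?firstK.
Qed.

Lemma first_idem f x : first f (first f x) = first f x.
Proof. by apply: eq_first; rewrite firstK. Qed.

Lemma computable_first f : computable_fun f -> computable_fun (first f).
Proof.
move=> fR; apply: (@computable_mu (fun y x => f y == f x)).
- by recursive_tac.
- by move=> x; rewrite firstK.
- by move=> x i /eqP; exact: first_min.
Qed.

(** The complement contains exactly one point of each nonempty fibre of [f], so [f] is injective
    there. *)
Definition repeats (f : nat -> nat) : set nat := [set x | first f x != x].

Lemma computable_repeats f : computable_fun f -> computable_set (repeats f).
Proof.
move=> /computable_first fR; apply: (@computable_set_pred (fun x => first f x != x)) => //.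
by recursive_tac.
Qed.

Lemma first_repeats f x : ~ repeats f (first f x).
Proof. by rewrite /repeats /= first_idem eqxx. Qed.

(** * Turning a many-one reduction into a finite-one reduction *)

Lemma ce_repeatsD (A B : set nat) (f q : nat -> nat) :
  D_maximal A -> computable_fun f -> computable_fun q ->
  (forall x, A (first f x) <-> A x) ->
  (forall n, (A `|` repeats f) n <-> B (q n)) ->
  ce (repeats q `\` (A `|` repeats f)).
Proof.
move=> [ceA ncA maxA] fR qR Af; set C := A `|` repeats f => CB.
have firstR := computable_first fR; have firstqR := computable_first qR.
have ceS : ce (first f @^-1` repeats q).
  exact: ce_preimage firstR (ce_computable (computable_repeats qR)).
have [ceW|[R [RR AR RW]]] :=
  maxA _ (ceU ceA ceS) (@subsetUl _ A (first f @^-1` repeats q)).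
  (* First alternative: [first f] preserves membership in [A] and fixes the points outside
     [repeats f], so it maps the c.e. difference onto the required set. *)
  have := ce_image firstR ceW; congr ce; apply/seteqP; split=> n.
    case=> x [[//|Sx] nAx] <-; split=> //.
    by case=> [/Af//|]; exact: first_repeats.
  case=> Sn nCn; have fn : first f n = n.
    by apply/eqP; apply: contrapT => /negP Nn; apply: nCn; right.
  exists n => //; split; first by right; rewrite /= fn.
  by move=> An; apply: nCn; left.
(* The least element of the [q]-fibre of [first f x] lies outside [repeats q],
   so [R] decides whether it belongs to [A]: then [A] would be computable. *)
case: ncA; pose m x := first q (first f x).
have mR : computable_fun m by exact: computable_comp.
(* [q] agrees on [m x] and [first f x], so both or neither lie in [C]. Since [first f x] is not in
   [repeats f], for it [C] means [A]. *)
have Cm x : C (m x) <-> A x.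
  rewrite CB firstK -CB -(Af x); split=> [[//|/first_repeats//]|]; by left.
apply: (@computable_set_pred (fun x => (m x \in R) || (first f (m x) != m x))).
  by recursive_tac.
move=> x; rewrite -(Cm x); split=> [/orP[/set_mem Rm|]|[Am|->]].
- have [fm|Nm] := eqVneq (first f (m x)) (m x); last by right.
  have [Am|] := RW _ Rm; first by left.
  by rewrite /= fm => /first_repeats.
- by right.
- by apply/orP; left; apply/mem_set/AR.
- by rewrite orbT.
Qed.

(** The fibres of [d] have to be finite only within [repeats q \ C], which admits a constant [d]
    when that set is finite. *)
Lemma fo_reducible_repeats (C B : set nat) (q d : nat -> nat) :
  computable_fun q -> (forall n, C n <-> B (q n)) ->
  ce C -> ce B -> infinite_set B ->
  ce (repeats q `\` C) ->
  computable_fun d -> (forall n, ~ B (d n)) ->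
  (forall y, finite_set ((repeats q `\` C) `&` d @^-1` [set y])) ->
  fo_reducible C B.
Proof.
move=> qR qCB ceC ceB infB ceD dR dB dfin.
have [b [bR bB leb]] := infinite_ce_above ceB infB.
have SR := computable_repeats qR.
(* The complement is the union of [C] and the computable complement of [repeats q], hence c.e.; the
   case distinction below is therefore computable. *)
have TR : computable_set (repeats q `\` C).
  apply: ce_compl_computable => //; rewrite setCD setUC; apply: ceU => //.
  apply: ce_computable; apply: (@computable_set_pred (fun x => x \notin repeats q)).
    by recursive_tac.
  by move=> x; split=> [/negP nS /mem_set//|nS]; apply/negP => /set_mem.
exists (fun n => if n \in repeats q `\` C then d n
                 else if n \in repeats q then b n else q n); split.
- by recursive_tac.
- move=> n; case: ifP => [/set_mem[_ nC]|/negP nT].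
    by split=> // /dB.
  case: ifP => [/set_mem Sn|//]; split=> // _.
  by apply: contrapT => nC; apply: nT; apply/mem_set.
(* The fibre splits by the three cases: [dfin] bounds the first part, [n <= b n] the second, and off
   [repeats q] there is at most one point. *)
move=> y; apply: (@sub_finite_set _ _
  (((repeats q `\` C) `&` d @^-1` [set y]) `|`
   (`I_y.+1 `|` ((~` repeats q) `&` q @^-1` [set y])))).
  move=> n /=; case: ifP => [/set_mem|_]; first by left.
  case: ifP => [_ <-|/negP nS qn]; first by right; left; rewrite ltnS.
  by right; right; split=> // Sn; apply: nS; apply/mem_set.
rewrite !finite_setU; split=> //; split=> //.
have [[n0 [Sn0 qn0]]|nS] :=
  pselect (exists n, ((~` repeats q) `&` q @^-1` [set y]) n); last first.
  suff -> : (~` repeats q) `&` q @^-1` [set y] = set0 by exact: finite_set0.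
  by apply/seteqP; split=> // n Sn; case: nS; exists n.
apply: (@sub_finite_set _ _ [set n0]); last exact: finite_set1.
have first_id n : ~ repeats q n -> first q n = n.
  by move=> Sn; apply/eqP; apply: contrapT => /negP.
move=> n [Sn qn]; rewrite /= -(first_id n Sn) -(first_id n0 Sn0).
by apply: eq_first; exact: etrans qn (esym qn0).
Qed.

Lemma noncomputable_not_all (X : set nat) :
  ~ computable_set X -> exists x, ~ X x.
Proof.
move=> ncX; apply: contrapT => nex; apply: ncX.
apply: (@computable_set_pred predT) => [|x]; first exact: recursive_const.
by split=> // _; apply: contrapT => nXx; apply: nex; exists x.
Qed.

Lemma reduction_first (A B : set nat) f :
  (forall x, A x <-> B (f x)) -> forall x, A (first f x) <-> A x.
Proof. by move=> fAX x; rewrite fAX firstK -fAX. Qed.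

(** One reduction sends all repeats to a fixed [a] in [A]; the other is [first f], whose values are
    never repeats. *)
Lemma m_equivalent_setU_repeats (A : set nat) f :
  A !=set0 -> computable_fun f -> (forall x, A (first f x) <-> A x) ->
  m_equivalent (A `|` repeats f) A.
Proof.
move=> [a Aa] fR Af; have SR := computable_repeats fR.
have firstR := computable_first fR; split.
  exists (fun n => if n \in repeats f then a else n); split; first by recursive_tac.
  move=> n; case: ifP => [/set_mem Sn|/negP nS]; first by split=> // _; right.
  by split=> [[//|/mem_set]|]; [move/nS|left].
exists (first f); split=> // x; rewrite -(Af x).
by split=> [|[//|/first_repeats//]]; left.
Qed.

(** * Choice of [C] and comparison with an arbitrary [B] *)

Theorem theorem1p1 (A : set nat) (ceA : ce A) (ncA : ~ computable_set A)
    (DmaxA : D_maximal A) :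
  exists C : set nat, m_equivalent C A /\
    forall B : set nat, m_equivalent B A -> fo_reducible C B.
Proof.
have A0 : A !=set0.
  by apply/set0P/eqP => AE; apply: ncA; rewrite AE; exact: computable_finite.
(* Sets with this property are the finite and the immune ones. *)
pose no_infinite_ce (X : set nat) := forall D, ce D -> D `<=` X -> finite_set D.
(* [f], and with it [C], is fixed before [B] is given; the disjunction records which choice of [d]
   will be available. *)
have [f [fR Af Himm]] : exists f : nat -> nat,
    [/\ computable_fun f, forall x, A (first f x) <-> A x &
        no_infinite_ce (~` (A `|` repeats f)) \/
        forall B, m_equivalent B A -> ~ no_infinite_ce (~` B)].
  have [[B0 [[B0A [f [fR fAB0]]] immB0]]|nimm] :=
    pselect (exists B, m_equivalent B A /\ no_infinite_ce (~` B)); last first.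
    exists id; split=> [||]; first exact: computable_id.
      by move=> x; have := firstK id x => ->.
    by right=> B BA immB; apply: nimm; exists B.
  exists f; split=> //; first exact: reduction_first fAB0.
  left=> D ceD DC.
  (* [D] avoids [repeats f], so it is equinumerous with its image under [f], a c.e. set disjoint
     from [B0] and hence finite. *)
  have finj : {in D &, injective f}.
    have first_id n : n \in D -> first f n = n.
      by move=> /set_mem/DC nC; apply/eqP; apply: contrapT => /negP Sn; apply: nC; right.
    by move=> x y /first_id {2}<- /first_id {2}<-; exact: eq_first.
  rewrite -(eq_finite_set (inj_card_eq finj)).
  apply: immB0; first exact: ce_image.
  move=> _ [x Dx <-] /fAB0 Ax; by apply: (DC x Dx); left.
exists (A `|` repeats f); set C := A `|` repeats f in Himm *.
have CA : m_equivalent C A by exact: m_equivalent_setU_repeats.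
split=> // B BA; have [q [qR qCB]] := m_reducible_trans CA.1 BA.2.
have ceD : ce (repeats q `\` C) by exact: ce_repeatsD qCB.
have ncB : ~ computable_set B by move/(computable_m_reducible BA.2).
have infB : infinite_set B by move/computable_finite.
have ceC := ce_m_reducible CA.1 ceA; have ceB := ce_m_reducible BA.1 ceA.
case: Himm => [immC|nimm].
  have [c nBc] := noncomputable_not_all ncB.
  have cR : computable_fun (fun=> c) by exact: recursive_const.
  apply: (fo_reducible_repeats qR qCB ceC ceB infB ceD cR) => // y.
  (* All of [repeats q \ C] is finite, being a c.e. set disjoint from [C]. *)
  by apply: finite_setIl; apply: immC => // n [].
have [D [ceD' DB infD]] : exists D, [/\ ce D, D `<=` ~` B & infinite_set D].
  apply: contrapT => nD; apply: (nimm B BA) => D ceD' DB.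
  by apply: contrapT => infD; apply: nD; exists D.
have [d [dR dD led]] := infinite_ce_above ceD' infD.
apply: (fo_reducible_repeats qR qCB ceC ceB infB ceD dR) => [n|y]; first exact: DB.
(* By [n <= d n], only numbers up to [y] can be sent to [y]. *)
apply: (@sub_finite_set _ _ `I_y.+1); last exact: finite_II.
by move=> n [_ <-]; rewrite /= ltnS.
Qed.
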